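(* Let $\lambda$ be a nonzero real number and let $(f_{n,\lambda})_{n\ge0}$ and $(g_{n,\lambda})_{n\ge0}$ be sequences of real numbers. Then $$f_{n,\lambda}=\sum_{k=0}^{n}g_{k,\lambda}\,S_{1,\lambda}(n,k)\ \text{ for all integers } n\ge0$$ if and only if $$g_{n,\lambda}=\sum_{k=0}^{n}f_{k,\lambda}\,S_{2,\lambda}(n,k)\ \text{ for all integers } n\ge0.$$
   Context: For $x\in\mathbb{R}$: $(x)_0=1$, $(x)_n=x(x-1)\cdots(x-n+1)$ for $n\ge1$; $(x)_{0,\lambda}=1$, $(x)_{n,\lambda}=x(x-\lambda)\cdots(x-(n-1)\lambda)$ for $n\ge 1$. The degenerate Stirling numbers of the first kind $S_{1,\lambda}(n,l)$ and of the second kind $S_{2,\lambda}(n,l)$ are defined by the polynomial identities in $x$, for $n\ge0$: $(x)_n=\sum_{l=0}^n S_{1,\lambda}(n,l)(x)_{l,\lambda}$ and $(x)_{n,\lambda}=\sum_{l=0}^n S_{2,\lambda}(n,l)(x)_{l}$. *)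

(* Defs.v *)
From mathcomp Require Import all_boot all_order all_algebra.
From mathcomp Require Import boolp reals.
From mathcomp Require Import ring.

Set Implicit Arguments.
Unset Strict Implicit.
Unset Printing Implicit Defensive.

Import GRing.Theory.

Local Open Scope ring_scope.

Definition falling (R : realType) (x : R) (n : nat) : R :=
  \prod_(i < n) (x - i%:R).

Definition dfalling (R : realType) (lambda x : R) (n : nat) : R :=
  \prod_(i < n) (x - i%:R * lambda).

Lemma falling_dfalling1 (R : realType) (x : R) n : falling x n = dfalling 1 x n.
Proof. by apply: eq_bigr => i _; rewrite mulr1. Qed.

Lemma dfalling_expansion (R : realType) (a b : R) (n : nat) :
  exists c : nat -> R,
    forall x : R, dfalling a x n = \sum_(l < n.+1) c l * dfalling b x l.
Proof.
elim: n => [|n [c IH]].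
  exists (fun=> 1) => x.
  by rewrite /dfalling big_ord_recl !big_ord0 addr0 mulr1.
exists (fun l => (if l is l'.+1 then c l' else 0) +
  (if (l <= n)%N then c l * (l%:R * b - n%:R * a) else 0)) => x.
transitivity (\sum_(l < n.+1) (c l * dfalling b x l.+1 +
    c l * (l%:R * b - n%:R * a) * dfalling b x l)).
  rewrite {1}/dfalling big_ord_recr /= -/(dfalling a x n) IH mulr_suml.
  apply: eq_bigr => l _.
  rewrite [dfalling b x l.+1]/dfalling big_ord_recr /= -/(dfalling b x l).
  by ring.
under [RHS]eq_bigr do rewrite mulrDl.
rewrite !big_split /=; congr (_ + _).
  by rewrite [RHS]big_ord_recl mul0r add0r.
rewrite [RHS]big_ord_recr /= ltnn mul0r addr0.
by apply: eq_bigr => l _; rewrite -ltnS ltn_ord.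
Qed.

Lemma stirling1_exists (R : realType) (lambda : R) (n : nat) :
  exists c : nat -> R,
    forall x : R, falling x n = \sum_(l < n.+1) c l * dfalling lambda x l.
Proof.
have [c Hc] := dfalling_expansion 1 lambda n.
by exists c => x; rewrite falling_dfalling1.
Qed.

Lemma stirling2_exists (R : realType) (lambda : R) (n : nat) :
  exists c : nat -> R,
    forall x : R, dfalling lambda x n = \sum_(l < n.+1) c l * falling x l.
Proof.
have [c Hc] := dfalling_expansion lambda 1 n; exists c => x.
by rewrite Hc; apply: eq_bigr => l _; rewrite falling_dfalling1.
Qed.

(* Characterized by stirling1E and stirling2E below: the values with l <= n are
   determined, because falling x l and dfalling lambda x l are monic of degree l
   in x; the values with l > n are unspecified. *)
Definition stirling1 (R : realType) (lambda : R) (n l : nat) : R :=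
  projT1 (cid (stirling1_exists lambda n)) l.

Definition stirling2 (R : realType) (lambda : R) (n l : nat) : R :=
  projT1 (cid (stirling2_exists lambda n)) l.

Lemma stirling1E (R : realType) (lambda : R) (n : nat) (x : R) :
  falling x n = \sum_(l < n.+1) stirling1 lambda n l * dfalling lambda x l.
Proof. exact: (projT2 (cid (stirling1_exists lambda n))). Qed.

Lemma stirling2E (R : realType) (lambda : R) (n : nat) (x : R) :
  dfalling lambda x n = \sum_(l < n.+1) stirling2 lambda n l * falling x l.
Proof. exact: (projT2 (cid (stirling2_exists lambda n))). Qed.

(* Main.v *)
Require Import Defs.
From mathcomp Require Import all_boot all_order all_algebra.
From mathcomp Require Import boolp reals.

Local Open Scope ring_scope.

Import GRing.Theory Num.Theory.

(** Expanding a basis element in the other basis and back, and comparing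
    coefficients, shows that the two triangular connection matrices are inverse
    to each other.  Comparing coefficients is legitimate because, for [b != 0],
    the functions [dfalling b ^~ l] form a triangular system when evaluated at
    the points [k * b]. *)

Lemma dfalling_nat_eq0 (R : realType) (b : R) (k l : nat) :
  (k < l)%N -> dfalling b (k%:R * b) l = 0.
Proof.
move=> kl; rewrite /dfalling (bigD1 (Ordinal kl)) //=.
by rewrite subrr mul0r.
Qed.

Lemma dfalling_nat_neq0 (R : realType) (b : R) (k : nat) :
  b != 0 -> dfalling b (k%:R * b) k != 0.
Proof.
move=> b0; apply/prodf_neq0 => i _.
by rewrite -mulrBl mulf_neq0 // subr_eq0 eqr_nat gtn_eqF.
Qed.

Lemma dfalling_free (R : realType) (b : R) (n : nat) (c : nat -> R) :
  b != 0 -> (forall x, \sum_(l < n.+1) c l * dfalling b x l = 0) ->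
  forall k, (k <= n)%N -> c k = 0.
Proof.
move=> b0 cE k; elim/ltn_ind: k => k IH kn.
(* At [k * b] the terms with [l > k] contain a zero factor and those with [l < k] vanish by
   induction, so only [c k] times a nonzero value remains. *)
have := cE (k%:R * b); rewrite (bigD1 (Ordinal (kn : (k < n.+1)%N))) //=.
rewrite big1 ?addr0 => [/eqP|l lk].
  by rewrite mulf_eq0 (negbTE (dfalling_nat_neq0 R b k b0)) orbF => /eqP.
have [lk'|kl] := ltnP l k; first by rewrite IH ?mul0r // (leq_trans (ltnW lk')).
rewrite dfalling_nat_eq0 ?mulr0 // ltn_neqAle kl andbT eq_sym.
by apply: contra lk => /eqP lk; apply/eqP/val_inj.
Qed.

(** With [u] arbitrary, the same coefficients serve for [dfalling b x] and for the sequence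
    replacing it. *)
Lemma triangular_sum_comp (R : pzRingType) (a : nat -> R) (B : nat -> nat -> R)
    (u : nat -> R) (n : nat) :
  \sum_(l < n.+1) a l * (\sum_(k < l.+1) B l k * u k) =
  \sum_(k < n.+1) (\sum_(l < n.+1 | (k <= l)%N) a l * B l k) * u k.
Proof.
under [RHS]eq_bigr do rewrite mulr_suml big_mkcond.
rewrite exchange_big; apply: eq_bigr => l _ /=.
rewrite mulr_sumr -big_mkcond (big_ord_widen n.+1 (fun k => a l * (B l k * u k))) //=.
by apply: eq_big => [k|k _]; rewrite ?ltnS ?mulrA.
Qed.

(* The coefficients of a double expansion are determined by the identity of
   functions of [x], so the sequence [dfalling b x] may be replaced in it by an
   arbitrary sequence [u]. *)
Lemma dfalling_umbral (R : realType) (b : R) (n : nat) (a : nat -> R)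
    (B : nat -> nat -> R) (u : nat -> R) :
  b != 0 ->
  (forall x, dfalling b x n =
     \sum_(l < n.+1) a l * (\sum_(k < l.+1) B l k * dfalling b x k)) ->
  u n = \sum_(l < n.+1) a l * (\sum_(k < l.+1) B l k * u k).
Proof.
move=> b0 E; rewrite triangular_sum_comp.
pose C k := \sum_(l < n.+1 | (k <= l)%N) a l * B l k.
have deltaE (v : nat -> R) : \sum_(k < n.+1) (k == n :> nat)%:R * v k = v n.
  rewrite big_ord_recr /= eqxx mul1r big1 ?add0r // => k _.
  by rewrite ltn_eqF // mul0r.
(* Both [C] and the Kronecker delta at [n] expand [dfalling b x n], so freeness identifies them. *)
have C_delta k : (k <= n)%N -> C k - (k == n)%:R = 0.
  apply: (@dfalling_free R b n (fun k => C k - (k == n)%:R)) => // x.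
  under eq_bigr do rewrite mulrBl.
  by rewrite sumrB deltaE E triangular_sum_comp subrr.
rewrite -[LHS]deltaE; apply: eq_bigr => k _.
by have /eqP := C_delta k (ltn_ord k); rewrite subr_eq0 => /eqP <-.
Qed.

Theorem theorem2 (R : realType) (lambda : R) (hlambda : lambda != 0)
    (f g : nat -> R) :
  (forall n : nat, f n = \sum_(k < n.+1) g k * stirling1 lambda n k) <->
  (forall n : nat, g n = \sum_(k < n.+1) f k * stirling2 lambda n k).
Proof.
split=> E n.
- rewrite (@dfalling_umbral R lambda n (stirling2 lambda n) (stirling1 lambda) g)
    // => [|x].
    apply: eq_bigr => l _; rewrite mulrC E; congr (_ * _).
    by apply: eq_bigr => k _; rewrite mulrC.
  by rewrite stirling2E; apply: eq_bigr => l _; rewrite -stirling1E.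
(* The round trip now starts from [falling], seen as [dfalling] with [b = 1], and [f] replaces this
   basis. *)
- rewrite (@dfalling_umbral R 1 n (stirling1 lambda n) (stirling2 lambda) f)
    ?oner_eq0 // => [|x].
    apply: eq_bigr => l _; rewrite mulrC E; congr (_ * _).
    by apply: eq_bigr => k _; rewrite mulrC.
  rewrite -falling_dfalling1 (stirling1E lambda); apply: eq_bigr => l _.
  rewrite stirling2E; congr (_ * _).
  by apply: eq_bigr => k _; rewrite falling_dfalling1.
Qed.
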